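(* There is an absolutely continuous function $f:[0,1]\to\mathbb{R}$ whose graph $G_f=\{(x,f(x)):x\in[0,1]\}$ is strongly porous, but every monotone subset of $G_f$ is nowhere dense in $G_f$. In particular, $G_f$ is not $\sigma$-monotone.
   Context: A set $X\subseteq\mathbb{R}^2$ is strongly porous if there is $p>0$ such that for every $x\in\mathbb{R}^2$ and every $r\in(0,\operatorname{diam}X)$ there is $y\in\mathbb{R}^2$ with $B(y,pr)\subseteq B(x,r)\setminus X$ (Euclidean balls). A metric space $(X,d)$ is monotone if there are a linear order $<$ on $X$ and $c>0$ with $d(x,y)\le c\,d(x,z)$ whenever $x<y<z$; it is $\sigma$-monotone if it is a countable union of monotone subspaces. *)

(* Defs.v *)
From mathcomp Require Import all_boot all_order all_algebra.
From mathcomp Require Import all_classical all_reals all_analysis.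
Set Implicit Arguments. Unset Strict Implicit. Unset Printing Implicit Defensive.
Import Order.TTheory GRing.Theory Num.Theory.
Local Open Scope classical_set_scope.
Local Open Scope ring_scope.

Section Defs.
Variable R : realType.

Definition edist (p q : R * R) : R :=
  Num.sqrt ((p.1 - q.1) ^+ 2 + (p.2 - q.2) ^+ 2).

Definition eball (y : R * R) (r : R) : set (R * R) := [set z | edist y z < r].

Definition ediam (X : set (R * R)) : \bar R :=
  ereal_sup [set e | exists x y, X x /\ X y /\ e = (edist x y)%:E].

Definition strongly_porous (X : set (R * R)) : Prop :=
  exists p : R, 0 < p /\
    forall (x : R * R) (r : R), 0 < r -> (r%:E < ediam X)%E ->
      exists y : R * R, eball y (p * r) `<=` eball x r `\` X.

Definition monotone_set (X : set (R * R)) : Prop :=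
  exists (lt : R * R -> R * R -> Prop) (c : R),
    [/\ (forall x, X x -> ~ lt x x),
        (forall x y z, X x -> X y -> X z -> lt x y -> lt y z -> lt x z),
        (forall x y, X x -> X y -> x <> y -> lt x y \/ lt y x),
        0 < c &
        forall x y z, X x -> X y -> X z -> lt x y -> lt y z ->
          edist x y <= c * edist x z].

Definition sigma_monotone (X : set (R * R)) : Prop :=
  exists A : nat -> set (R * R),
    (forall n, A n `<=` X /\ monotone_set (A n)) /\ X = \bigcup_n A n.

Definition rel_closure (Y A : set (R * R)) : set (R * R) :=
  [set p | Y p /\ forall e : R, 0 < e -> exists a, A a /\ edist p a < e].

Definition rel_interior (Y S : set (R * R)) : set (R * R) :=
  [set p | Y p /\ exists e : R, 0 < e /\
             forall q, Y q -> edist p q < e -> S q].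

Definition nowhere_dense_in (Y A : set (R * R)) : Prop :=
  rel_interior Y (rel_closure Y A) = set0.

Definition abs_continuous_on (a b : R) (f : R -> R) : Prop :=
  forall eps : R, 0 < eps -> exists delta : R, 0 < delta /\
    forall (n : nat) (u v : 'I_n -> R),
      (forall i, a <= u i /\ u i <= v i /\ v i <= b) ->
      (forall i j, i != j -> v i <= u j \/ v j <= u i) ->
      \sum_(i < n) (v i - u i) < delta ->
      \sum_(i < n) `|f (v i) - f (u i)| < eps.

Definition graph01 (f : R -> R) : set (R * R) :=
  [set p | 0 <= p.1 <= 1 /\ p.2 = f p.1].

End Defs.

(* Main.v *)
Require Import Defs.
From mathcomp Require Import all_boot all_order all_algebra.
From mathcomp Require Import all_classical all_reals all_analysis.
From mathcomp Require Import lra.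
(* The analysis library has its own [edist]. *)
Import Defs.
Set Implicit Arguments. Unset Strict Implicit. Unset Printing Implicit Defensive.
Import Order.TTheory GRing.Theory Num.Theory numFieldNormedType.Exports.
Local Open Scope classical_set_scope.
Local Open Scope ring_scope.

(** The function is a sum of steep tents, added one at a time over a dense set
    of apexes, each tiny compared with the geometry of the partial sum it is
    added to and steep compared with its slopes.  The heights are summable, so
    the sum is absolutely continuous.  A ball of radius [r] meets boundedly many
    affine pieces of the partial sum relevant at scale [r], and all later tents
    are negligible at that scale, which leaves room for a hole.

    If a subset of the graph over a dense set of abscissas is monotone for some
    order, then on the two sides of a steep tent the order must be that of the
    abscissas or its reverse: a point lying strictly between two others in the
    order is close to every arc joining them, by the monotonicity inequality at
    two nearby points of the arc on either side of it.  But the apex is far from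
    the feet, which are close to each other, so it cannot lie between them. *)

(** * Tents: Lipschitz bound, affine pieces and variation *)

Section Tent.
Variable R : realType.
Implicit Types q d s x y u v : R.

Definition tent q d s x : R := s * Num.max 0 (d - `|x - q|).

Lemma tent_ge0 q d s x : 0 <= s -> 0 <= tent q d s x.
Proof. by move=> s0; rewrite mulr_ge0// le_max lexx. Qed.

Lemma tent_le q d s x : 0 <= s -> 0 <= d -> tent q d s x <= s * d.
Proof.
by move=> s0 d0; rewrite ler_wpM2l// ge_max d0 /= gerBl.
Qed.

Lemma tent_center q d s : 0 <= d -> tent q d s q = s * d.
Proof. by move=> d0; rewrite /tent subrr normr0 subr0 max_r. Qed.

Lemma tent_left q d s : 0 <= d -> tent q d s (q - d) = 0.
Proof.
by move=> d0; rewrite /tent addrAC subrr sub0r normrN ger0_norm// subrr maxxx mulr0.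
Qed.

Lemma tent_right q d s : 0 <= d -> tent q d s (q + d) = 0.
Proof.
by move=> d0; rewrite /tent addrAC subrr add0r ger0_norm// subrr maxxx mulr0.
Qed.

(** For [a <= b], the projection onto [[a, b]]. Projecting onto the support of a tent keeps disjoint
    intervals disjoint and discards the lengths on which the tent vanishes. *)
Definition clamp a b x : R := Num.max a (Num.min b x).

Lemma clamp_le a b u v : u <= v -> clamp a b u <= clamp a b v.
Proof.
move=> uv; rewrite /clamp; case: (leP b u) => ?; case: (leP b v) => ?;
  case: (leP a b) => ?; case: (leP a u) => ?; case: (leP a v) => ?; lra.
Qed.

Lemma clamp_itv a b x : a <= b -> a <= clamp a b x /\ clamp a b x <= b.
Proof.
move=> ab; rewrite /clamp; case: (leP b x) => ?; case: (leP a b) => ?;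
  case: (leP a x) => ?; split; lra.
Qed.

Lemma clamp_contract a b u v : u <= v -> clamp a b v - clamp a b u <= v - u.
Proof.
move=> uv; rewrite /clamp; case: (leP b u) => ?; case: (leP b v) => ?;
  case: (leP a b) => ?; case: (leP a u) => ?; case: (leP a v) => ?; lra.
Qed.

Lemma tent_clampE q d s x : 0 <= d ->
  tent q d s x = s * (d - `|clamp (q - d) (q + d) x - q|).
Proof.
move=> d0; congr (_ * _); rewrite /clamp.
have [?|?] := leP (q + d) x.
  rewrite (@max_r _ _ (q - d)); last lra.
  rewrite max_l; first by rewrite ger0_norm; lra.
  by rewrite ger0_norm; lra.
have [?|?] := leP (q - d) x.
  by rewrite max_r//; case: (ger0P (x - q)) => ?; lra.
rewrite max_l; first by rewrite ler0_norm; lra.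
by rewrite ler0_norm; lra.
Qed.

Lemma tent_clamp q d s u v : 0 <= s -> 0 <= d -> u <= v ->
  `|tent q d s v - tent q d s u| <=
  s * (clamp (q - d) (q + d) v - clamp (q - d) (q + d) u).
Proof.
move=> s0 d0 uv; rewrite !tent_clampE// -mulrBr normrM (ger0_norm s0) ler_wpM2l//.
set cu := clamp _ _ u; set cv := clamp _ _ v.
have -> : d - `|cv - q| - (d - `|cu - q|) = `|cu - q| - `|cv - q| by lra.
apply: le_trans (ler_dist_dist _ _) _.
have -> : cu - q - (cv - q) = cu - cv by lra.
by rewrite distrC ger0_norm// subr_ge0 clamp_le.
Qed.

Lemma tent_lip q d s u v : 0 <= s -> 0 <= d ->
  `|tent q d s v - tent q d s u| <= s * `|v - u|.
Proof.
move=> s0 d0; wlog uv : u v / u <= v.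
  move=> H; case: (leP u v) => [|/ltW] uv; first exact: H.
  by rewrite distrC (distrC v); exact: H.
apply: le_trans (tent_clamp _ s0 d0 uv) _.
by rewrite ler_wpM2l// (ger0_norm (x := v - u)) ?subr_ge0// clamp_contract.
Qed.

Lemma tent_affine q d s u v : 0 <= d ->
  (forall p, p \in [:: q - d; q; q + d] -> p <= u \/ v <= p) ->
  exists m b : R, forall x, u < x < v -> tent q d s x = m * x + b.
Proof.
move=> d0 H.
have H1 : q - d <= u \/ v <= q - d by apply: H; rewrite !inE eqxx.
have H2 : q <= u \/ v <= q by apply: H; rewrite !inE eqxx orbT.
have H3 : q + d <= u \/ v <= q + d by apply: H; rewrite !inE eqxx !orbT.
rewrite /tent; case: H1 => H1; last first.
  exists 0, 0 => x /andP[xu xv]; rewrite max_l; first lra.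
  by case: (ger0P (x - q)) => ?; lra.
case: H3 => H3.
  exists 0, 0 => x /andP[xu xv]; rewrite max_l; first lra.
  by case: (ger0P (x - q)) => ?; lra.
case: H2 => H2.
  exists (- s), (s * (q + d)) => x /andP[xu xv].
  rewrite ger0_norm ?max_r; lra.
exists s, (s * (d - q)) => x /andP[xu xv].
rewrite ltr0_norm ?max_r; lra.
Qed.

(** Removing one interval [i] splits the others into those inside [[a, u i]] and those inside
    [[v i, b]], and induction on the number of intervals applies to both families. *)
Lemma sum_disjoint_le n (u v : 'I_n -> R) (S : {set 'I_n}) a b : a <= b ->
  (forall i, i \in S -> a <= u i /\ u i <= v i /\ v i <= b) ->
  (forall i j, i != j -> v i <= u j \/ v j <= u i) ->
  \sum_(i in S) (v i - u i) <= b - a.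
Proof.
move=> + + disj; elim: {S}#|S| {-2}S (leqnn #|S|) a b => [|k IH] S cS a b ab H.
  have -> : S = finset.set0 by apply/eqP; rewrite -cards_eq0 -leqn0.
  by rewrite big_set0; lra.
have [->|[i iS]] := set_0Vmem S; first by rewrite big_set0; lra.
have [aui [uvi vib]] := H _ iS.
rewrite (big_setD1 i)//=.
rewrite (big_setID [set j | v j <= u i])/=.
have cS' (A : {set 'I_n}) : A \subset (S :\ i)%SET -> (#|A| <= k)%N.
  move=> /subset_leq_card h; apply: leq_trans h _.
  by move: cS; rewrite (cardsD1 i) iS.
have -> : b - a = (v i - u i) + ((u i - a) + (b - v i)) by lra.
rewrite lerD2l lerD//; apply: IH => //.
- by apply: cS'; exact: subsetIl.
- move=> j; rewrite !inE => /andP[/andP[_ jS] vj].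
  by have [? [? ?]] := H _ jS.
- by apply: cS'; exact: subsetDl.
- move=> j; rewrite !inE => /andP[vj /andP[ji jS]].
  have [? [? ?]] := H _ jS; split; last by [].
  by case: (disj _ _ ji) => // h; rewrite h in vj.
Qed.

(** The increments are at most [s] times the lengths of the clamped intervals, which are disjoint in
    an interval of length [2 * d]. *)
Lemma tent_variation q d s n (u v : 'I_n -> R) : 0 <= s -> 0 <= d ->
  (forall i, u i <= v i) ->
  (forall i j, i != j -> v i <= u j \/ v j <= u i) ->
  \sum_(i < n) `|tent q d s (v i) - tent q d s (u i)| <= 2 * (s * d).
Proof.
move=> s0 d0 uv disj; set c := clamp (q - d) (q + d).
apply: (@le_trans _ _ (\sum_(i in [set: 'I_n]%SET) s * (c (v i) - c (u i)))).
  rewrite [leRHS](eq_bigl xpredT); last by move=> i; rewrite inE.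
  by apply: ler_sum => i _; exact: tent_clamp.
rewrite -mulr_sumr.
have -> : 2 * (s * d) = s * ((q + d) - (q - d)) by lra.
rewrite ler_wpM2l//; apply: sum_disjoint_le; first lra.
  move=> i _; have qd : q - d <= q + d by lra.
  split; first by case: (clamp_itv (u i) qd).
  by split; [exact: clamp_le|case: (clamp_itv (v i) qd)].
by move=> i j /disj[] h; [left|right]; exact: clamp_le.
Qed.

End Tent.

(** * The sum of tents and its absolute continuity *)

Section Construction.
Variable R : realType.
Implicit Types (x y u v e r : R) (n k : nat).

Lemma separation_exists (s : seq R) :
  exists e : R, 0 < e /\ {in s &, forall x y, x != y -> e <= `|x - y|}.
Proof.
elim: s => [|a s [e [e0 IH]]]; first by exists 1.
have [e' [e'0 H]] : exists e', 0 < e' /\ {in s, forall x, x != a -> e' <= `|x - a|}.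
  elim: s {e e0 IH} => [|b s [e [e0 IH]]]; first by exists 1.
  have [->|ba] := eqVneq b a.
    exists e; split => // x; rewrite inE => /predU1P[->|]; first by rewrite eqxx.
    exact: IH.
  exists (Num.min e `|b - a|); split.
    by rewrite lt_min e0 normr_gt0 subr_eq0.
  move=> x; rewrite inE => /predU1P[->|xs] xa; first by rewrite ge_min lexx orbT.
  by rewrite ge_min IH.
exists (Num.min e e'); split; first by rewrite lt_min e0 e'0.
move=> x y; rewrite !inE => /predU1P[->|xs] /predU1P[->|ys] xy.
- by rewrite eqxx in xy.
- by rewrite ge_min distrC [X in _ || X]H ?orbT// eq_sym.
- by rewrite ge_min [X in _ || X]H ?orbT.
- by rewrite ge_min IH.
Qed.

Definition separation (s : seq R) : R := sval (cid (separation_exists s)).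

Lemma separation_gt0 s : 0 < separation s.
Proof. by rewrite /separation; case: cid => e []. Qed.

Lemma separation_le s x y : x \in s -> y \in s -> x != y ->
  separation s <= `|x - y|.
Proof. by rewrite /separation; case: cid => e [_ H] /= xs ys; exact: H. Qed.

(** Every pair of a rational apex and a steepness index occurs, so each rational carries tents of
    unbounded relative steepness. Numbers that code no pair yield one more tent at [0]. *)
Definition spot n : rat * nat := odflt (0, 0%N) (unpickle n).
Definition apex n : R := ratr (spot n).1.

(** In the final graph the feet of a tent of half-width [d], added to a partial sum with Lipschitz
    constant [L], have coordinate differences of sum at most [(3 + 2 * L) * d]. The larger factor
    [5 + 2 * L] absorbs the slope of the partial sum and the later tents, so that the apex exceeds
    both feet by more than [(spot n).2] times this bound. *)
Definition slope_for n (L : R) : R := (spot n).2.+1%:R * (5 + 2 * L).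
(** This makes the height [r / 256]. As scales at least halve, this tent and all later ones add at
    most [r / 128]. *)
Definition hwidth_for n (L r : R) : R := r / 256 / slope_for n L.

(* A state consists of the breakpoints of the current partial sum, a Lipschitz
   constant of it, and a scale that dominates all further modifications. *)
Fixpoint state n : seq R * R * R :=
  if n is m.+1 then
    let: (P, L, r) := state m in
    let d := hwidth_for m L r in
    let P' := [:: apex m - d; apex m; apex m + d] ++ P in
    (P', L + slope_for m L,
     Num.min (Num.min (r / 2) d) (separation P' / 2))
  else ([::], 0, 1).

Definition breaks n := (state n).1.1.
Definition lip n := (state n).1.2.
Definition scale n := (state n).2.
Definition slope n := slope_for n (lip n).
Definition hwidth n := hwidth_for n (lip n) (scale n).

Lemma breaksS n : breaks n.+1 =
  [:: apex n - hwidth n; apex n; apex n + hwidth n] ++ breaks n.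
Proof. by rewrite /hwidth /lip /scale /breaks /=; case: (state n) => [[]]. Qed.

Lemma lipS n : lip n.+1 = lip n + slope n.
Proof. by rewrite /slope /lip /=; case: (state n) => [[]]. Qed.

(** The first bound makes the heights summable, the second makes later tents small compared with the
    width of the present one, and the third keeps distinct breakpoints two scales apart. *)
Lemma scaleS n : scale n.+1 =
  Num.min (Num.min (scale n / 2) (hwidth n)) (separation (breaks n.+1) / 2).
Proof.
by rewrite /hwidth /scale /lip /breaks /=; case: (state n) => [[]].
Qed.

Lemma slope_for_gt0 n (L : R) : 0 <= L -> 0 < slope_for n L.
Proof. by move=> L0; rewrite mulr_gt0//; lra. Qed.

Lemma lip_ge0 n : 0 <= lip n.
Proof.
by elim: n => [//|n IH]; rewrite lipS addr_ge0// ltW// slope_for_gt0.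
Qed.

Lemma slope_gt0 n : 0 < slope n.
Proof. exact/slope_for_gt0/lip_ge0. Qed.

Lemma hwidth_for_gt0 n (L r : R) : 0 <= L -> 0 < r -> 0 < hwidth_for n L r.
Proof.
move=> L0 r0.
exact: divr_gt0 (divr_gt0 r0 (ltr0Sn _ _)) (slope_for_gt0 n L0).
Qed.

Lemma scale_gt0 n : 0 < scale n.
Proof.
elim: n => [|n IH]; first exact: ltr01.
rewrite scaleS !lt_min (hwidth_for_gt0 _ (lip_ge0 n) IH).
by rewrite (divr_gt0 IH)// (divr_gt0 (separation_gt0 _)).
Qed.

Lemma hwidth_gt0 n : 0 < hwidth n.
Proof. exact: hwidth_for_gt0 (lip_ge0 n) (scale_gt0 n). Qed.

Lemma heightE n : slope n * hwidth n = scale n / 256.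
Proof. by rewrite mulrC divfK// gt_eqF// slope_gt0. Qed.

Lemma scaleS_le_half n : scale n.+1 <= scale n / 2.
Proof. by rewrite scaleS !ge_min lexx. Qed.

Lemma scaleS_le_hwidth n : scale n.+1 <= hwidth n.
Proof. by rewrite scaleS !ge_min lexx orbT. Qed.

Lemma scale_separates n x y : x \in breaks n -> y \in breaks n -> x != y ->
  2 * scale n <= `|x - y|.
Proof.
case: n => [//|n] xP yP xy; have := separation_le xP yP xy.
have : scale n.+1 <= separation (breaks n.+1) / 2 by rewrite scaleS !ge_min lexx orbT.
lra.
Qed.

Lemma scale_le n : scale n * n.+1%:R <= 1.
Proof.
elim: n => [|n IH]; first by rewrite mulr1.
move: IH; rewrite -!natr1 => IH.
have h := scaleS_le_half n; have s0 := scale_gt0 n.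
have : scale n.+1 * (n%:R + 1 + 1) <= scale n / 2 * (n%:R + 1 + 1).
  by rewrite ler_wpM2r// !addr_ge0.
have : 0 <= scale n * n%:R by rewrite mulr_ge0// ltW.
lra.
Qed.

Lemma scale_lt e : 0 < e -> exists n, scale n < e.
Proof.
move=> e0; exists (Num.truncn e^-1).
have := scale_le (Num.truncn e^-1); set n := Num.truncn _ => h.
have h2 : e^-1 < n.+1%:R by exact: truncnS_gt.
rewrite ltNge; apply/negP => es.
have : e * e^-1 < e * n.+1%:R by rewrite ltr_pM2l.
rewrite divff ?gt_eqF// => h3.
have : e * n.+1%:R <= scale n * n.+1%:R by rewrite ler_wpM2r.
lra.
Qed.

Definition bump n : R -> R := tent (apex n) (hwidth n) (slope n).

Definition approx n x : R := \sum_(k < n) bump k x.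

Lemma approxS n x : approx n.+1 x = approx n x + bump n x.
Proof. by rewrite /approx big_ord_recr. Qed.

Lemma bump_ge0 n x : 0 <= bump n x.
Proof. exact/tent_ge0/ltW/slope_gt0. Qed.

Lemma bump_le n x : bump n x <= scale n / 256.
Proof. by rewrite -heightE tent_le// ltW// (slope_gt0, hwidth_gt0). Qed.

Lemma bump_lip n u v : `|bump n v - bump n u| <= slope n * `|v - u|.
Proof. by rewrite tent_lip// ltW// (slope_gt0, hwidth_gt0). Qed.

Lemma approx_nondecreasing m n x : (m <= n)%N -> approx m x <= approx n x.
Proof.
move=> /subnK <-; elim: (n - m)%N => [//|k IH].
by rewrite addSn approxS (le_trans IH)// lerDl bump_ge0.
Qed.

(** A bump adds at most [scale n / 256], and the halving of the scale lowers the margin by at least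
    as much. So the limit is squeezed between [approx n] and [approx n + scale n / 128]. *)
Lemma approx_upper_nonincreasing m n x : (m <= n)%N ->
  approx n x + scale n / 128 <= approx m x + scale m / 128.
Proof.
move=> /subnK <-; elim: (n - m)%N => [//|k IH].
rewrite addSn approxS (le_trans _ IH)//.
have := bump_le (k + m) x; have := scaleS_le_half (k + m); lra.
Qed.

Lemma approx_lip n u v : `|approx n v - approx n u| <= lip n * `|v - u|.
Proof.
elim: n => [|n IH]; first by rewrite /approx !big_ord0 subrr normr0 mul0r.
rewrite !approxS lipS mulrDl.
have -> : approx n v + bump n v - (approx n u + bump n u) =
  (approx n v - approx n u) + (bump n v - bump n u) by lra.
by rewrite (le_trans (ler_normD _ _))// lerD// bump_lip.
Qed.

Lemma approx_affine n u v :
  (forall p, p \in breaks n -> p <= u \/ v <= p) ->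
  exists m b : R, forall x, u < x < v -> approx n x = m * x + b.
Proof.
elim: n => [|n IH] H.
  by exists 0, 0 => x _; rewrite /approx big_ord0; lra.
have [m [b mb]] : exists m b : R, forall x, u < x < v -> approx n x = m * x + b.
  by apply: IH => p pP; apply: H; rewrite breaksS mem_cat pP orbT.
have [m' [b' mb']] : exists m b : R, forall x, u < x < v -> bump n x = m * x + b.
  apply: tent_affine; first exact/ltW/hwidth_gt0.
  by move=> p pP; apply: H; rewrite breaksS mem_cat pP.
exists (m + m'), (b + b') => x xuv.
by rewrite approxS mb// mb'//; lra.
Qed.

(** The Lipschitz constant handles the first [N] bumps. A later bump [K] has variation at most
    [scale K / 128], which is at most [(scale K - scale K.+1) / 64], and these bounds telescope. *)
Lemma approx_variation (N M n : nat) (u v : 'I_n -> R) : (N <= M)%N ->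
  (forall i, u i <= v i) ->
  (forall i j, i != j -> v i <= u j \/ v j <= u i) ->
  \sum_(i < n) `|approx M (v i) - approx M (u i)| <=
    lip N * \sum_(i < n) (v i - u i) + (scale N - scale M) / 64.
Proof.
move=> /subnK <- uv disj; elim: (M - N)%N => [|k IH].
  rewrite add0n subrr mul0r addr0 mulr_sumr ler_sum// => i _.
  by rewrite (le_trans (approx_lip _ _ _))// (@ger0_norm _ (v i - u i))// subr_ge0.
rewrite addSn; set K := (k + N)%N in IH *.
have var : \sum_(i < n) `|bump K (v i) - bump K (u i)| <= 2 * (scale K / 256).
  rewrite -heightE; apply: tent_variation => //; apply: ltW.
    exact: slope_gt0.
  exact: hwidth_gt0.
have : \sum_(i < n) `|approx K.+1 (v i) - approx K.+1 (u i)| <=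
    \sum_(i < n) `|approx K (v i) - approx K (u i)| +
    \sum_(i < n) `|bump K (v i) - bump K (u i)|.
  rewrite -big_split ler_sum// => i _.
  rewrite !approxS; apply: le_trans (ler_normD _ _).
  by rewrite le_eqVlt; apply/orP; left; apply/eqP; congr `|_|; lra.
have := scaleS_le_half K; lra.
Qed.

(** The tents are nonnegative, so the supremum of the partial sums is the sum of the series. *)
Definition limit x : R := sup [set approx n x | n in [set: nat]].

Lemma approx_bounded x : has_sup [set approx n x | n in [set: nat]].
Proof.
split; first by exists (approx 0 x), 0%N.
exists (approx 0 x + scale 0 / 128) => _ [n _ <-].
have := approx_upper_nonincreasing x (leq0n n); have := scale_gt0 n; lra.
Qed.

Lemma approx_le_limit n x : approx n x <= limit x.
Proof. by apply: ub_le_sup; [case: (approx_bounded x)|exists n]. Qed.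

Lemma limit_le_approx n x : limit x <= approx n x + scale n / 128.
Proof.
apply: ge_sup; first by case: (approx_bounded x).
move=> _ [m _ <-]; have s0 k := scale_gt0 k.
have [mn|/ltnW nm] := leqP m n.
  have := approx_nondecreasing x mn; have := s0 n; lra.
have := approx_upper_nonincreasing x nm; have := s0 m; lra.
Qed.

Lemma limit_continuous x e : 0 < e ->
  exists r, 0 < r /\ forall y, `|y - x| < r -> `|limit y - limit x| < e.
Proof.
move=> e0; have [n sn] := scale_lt e0.
have L0 := lip_ge0 n; exists (e / 2 / (lip n + 1)).
split; first by rewrite !divr_gt0//; lra.
move=> y; rewrite ltr_pdivlMr; last lra.
move=> yx; have := approx_lip n x y.
have -> : lip n * `|y - x| = `|y - x| * (lip n + 1) - `|y - x| by lra.
have := normr_ge0 (y - x).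
have := approx_le_limit n x; have := approx_le_limit n y.
have := limit_le_approx n x; have := limit_le_approx n y.
have := scale_gt0 n; rewrite ler_norml ltr_norml => ? ? ? ? ? ? /andP[? ?].
apply/andP; split; lra.
Qed.

Lemma limit_abs_continuous a b : abs_continuous_on a b limit.
Proof.
move=> e e0; have [N sN] := scale_lt e0.
have L0 := lip_ge0 N; exists (e / 2 / (lip N + 1)).
split; first by rewrite !divr_gt0//; lra.
move=> n u v uv disj.
have uv' i : u i <= v i by have [_ []] := uv i.
set S := \sum_(i < n) _; rewrite ltr_pdivlMr; last lra.
have S0 : 0 <= S by rewrite sumr_ge0// => i _; rewrite subr_ge0.
move=> Slt.
(* [delta] depends on [N] only. [M] may depend on the number of intervals, so that replacing [limit]
   by a partial sum costs little on all of them together. *)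
have [M sM] : exists M, scale M < e / (n%:R + 1).
  by apply: scale_lt; rewrite divr_gt0// ltr_wpDl.
move: sM; rewrite ltr_pdivlMr; last by rewrite ltr_wpDl.
set K := maxn N M => sM.
have := approx_variation (leq_maxl N M) uv' disj; rewrite -/S -/K => var.
have sK : scale K <= scale M.
  rewrite /K; have /subnK <- := leq_maxr N M; elim: (_ - _)%N => [//|k IH].
  rewrite addSn; have := scaleS_le_half (k + M); have := scale_gt0 (k + M); lra.
have : \sum_(i < n) `|limit (v i) - limit (u i)| <=
    \sum_(i < n) (`|approx K (v i) - approx K (u i)| + scale K / 128).
  apply: ler_sum => i _.
  have := approx_le_limit K (u i); have := approx_le_limit K (v i).
  have := limit_le_approx K (u i); have := limit_le_approx K (v i).
  have := ler_norm (approx K (v i) - approx K (u i)).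
  have := ler_norm (- (approx K (v i) - approx K (u i))); rewrite normrN.
  move=> ? ? ? ? ? ?; rewrite ler_norml; apply/andP; split; lra.
rewrite big_split/= sumr_const card_ord -mulr_natr.
have : scale K * n%:R <= scale M * n%:R by rewrite ler_wpM2r.
have := scale_gt0 M; have := scale_gt0 K; have := scale_gt0 N; lra.
Qed.

End Construction.

(** * The Euclidean distance against coordinate differences *)

Section Distance.
Variable R : realType.
Implicit Types p q : R * R.

Lemma edistC p q : edist p q = edist q p.
Proof. by rewrite /edist -sqrrN opprB -(sqrrN (p.2 - q.2)) opprB. Qed.

Lemma norm1_le_edist p q : `|p.1 - q.1| <= edist p q.
Proof. by rewrite -sqrtr_sqr ler_sqrt ?addr_ge0 ?sqr_ge0// lerDl sqr_ge0. Qed.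

Lemma norm2_le_edist p q : `|p.2 - q.2| <= edist p q.
Proof. by rewrite -sqrtr_sqr ler_sqrt ?addr_ge0 ?sqr_ge0// lerDr sqr_ge0. Qed.

Lemma edist_le_norms p q : edist p q <= `|p.1 - q.1| + `|p.2 - q.2|.
Proof.
have h : 0 <= `|p.1 - q.1| + `|p.2 - q.2| by rewrite addr_ge0.
rewrite -[leRHS](ger0_norm h) -[leRHS]sqrtr_sqr ler_sqrt ?sqr_ge0//.
rewrite [leRHS]sqrrD !real_normK ?num_real// lerD2r lerDl.
by rewrite mulrn_wge0// mulr_ge0.
Qed.

End Distance.

(** * Strong porosity of the graph *)

Section Porosity.
Variable R : realType.
Implicit Types (c r x y m b : R).

(** For each point in turn, pass to the half of the current interval on the other side of its
    center. *)
Lemma shrink_avoiding (s : seq R) c r : 0 < r ->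
  exists c', `|c' - c| <= r - r / 2 ^+ size s /\
    {in s, forall q, q <= c' - r / 2 ^+ size s \/ c' + r / 2 ^+ size s <= q}.
Proof.
elim: s c r => [|q s IH] c r r0.
  by exists c; split => //; rewrite subrr normr0 expr0; lra.
have r20 : 0 < r / 2 by lra.
have -> : r / 2 ^+ size (q :: s) = r / 2 / 2 ^+ size s.
  by rewrite /= exprS invfM mulrA.
have [cq|qc] := leP c q.
  have [c' [c'c H]] := IH (c - r / 2) _ r20.
  move: c'c; rewrite ler_norml => /andP[? ?].
  exists c'; split; first by rewrite ler_norml; apply/andP; split; lra.
  by move=> p; rewrite inE => /predU1P[->|/H//]; right; lra.
have [c' [c'c H]] := IH (c + r / 2) _ r20.
move: c'c; rewrite ler_norml => /andP[? ?].
exists c'; split; first by rewrite ler_norml; apply/andP; split; lra.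
by move=> p; rewrite inE => /predU1P[->|/H//]; left; lra.
Qed.

(* An increasing graph passing below the center of a square misses the upper
   left quarter of the square; the other cases are symmetric. *)
Lemma affine_misses_quarter m b c y r : 0 < r ->
  exists c' y', [/\ `|c' - c| <= r / 2, `|y' - y| <= r / 2 &
    forall u v, `|u - c'| < r / 2 -> `|v - y'| < r / 2 -> v <> m * u + b].
Proof.
move=> r0.
have h1 e : `|e| = r / 2 -> forall z, `|(z + e) - z| <= r / 2.
  by move=> e2 z; rewrite addrC addKr e2.
have hp : `|r / 2| = r / 2 by rewrite ger0_norm; lra.
have hm : `|- (r / 2)| = r / 2 by rewrite normrN.
have [wy|yw] := leP (m * c + b) y; have [m0|m0] := leP 0 m.
- exists (c - r / 2), (y + r / 2); split; [exact: h1|exact: h1|].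
  move=> u v; rewrite !ltr_norml => /andP[? ?] /andP[? ?] vE.
  have : 0 <= m * (c - u) by rewrite mulr_ge0//; lra.
  lra.
- exists (c + r / 2), (y + r / 2); split; [exact: h1|exact: h1|].
  move=> u v; rewrite !ltr_norml => /andP[? ?] /andP[? ?] vE.
  have : 0 <= (- m) * (u - c) by rewrite mulr_ge0//; lra.
  lra.
- exists (c + r / 2), (y - r / 2); split; [exact: h1|exact: h1|].
  move=> u v; rewrite !ltr_norml => /andP[? ?] /andP[? ?] vE.
  have : 0 <= m * (u - c) by rewrite mulr_ge0//; lra.
  lra.
- exists (c - r / 2), (y - r / 2); split; [exact: h1|exact: h1|].
  move=> u v; rewrite !ltr_norml => /andP[? ?] /andP[? ?] vE.
  have : 0 <= (- m) * (c - u) by rewrite mulr_ge0//; lra.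
  lra.
Qed.

(* Between the scales [scale n.+1] and [scale n] a ball sees at most one
   breakpoint of the first [n] bumps and three of the next one, while the
   remaining bumps are negligible. *)
Lemma limit_strongly_porous : strongly_porous (graph01 (@limit R)).
Proof.
(* Avoiding four breakpoints shrinks [r / 2] to [r / 32], and the quarter square missed by the
   affine piece has half-side [r / 64]. Half of this is the radius of the hole; the other half
   absorbs the later tents, which add at most [scale n.+1 / 128 < r / 128]. *)
exists (1 / 128); split; first lra.
move=> [x0 y0] r r0 _.
have ex_n : exists n, scale R n.+1 < r.
  have [n sn] := scale_lt r0; exists n.
  have := scaleS_le_half R n; have := scale_gt0 R n; lra.
(* By minimality [r <= scale n] if [n] is positive, while for [n = 0] there are no earlier
   breakpoints, however large [r] is. *)
case: (ex_minnP ex_n) => n snr n_min.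
have sep x y : x \in breaks R n -> y \in breaks R n ->
    `|x - x0| < r / 2 -> `|y - x0| < r / 2 -> x = y.
  case: n {snr} n_min => [//|n] n_min xP yP xx yx.
  apply/eqP; apply: contraT => xy; have := scale_separates xP yP xy.
  have : r <= scale R n.+1.
    by rewrite leNgt; apply/negP => /n_min; rewrite ltnn.
  move: xx yx; rewrite !ltr_norml => /andP[? ?] /andP[? ?].
  by case: (ger0P (x - y)); lra.
(* If there is no old breakpoint nearby, [0] is avoided instead, so that four points are avoided in
   every case. *)
have [z zP] : exists z, forall x, x \in breaks R n -> `|x - x0| < r / 2 -> x = z.
  have [[z [zP zx]]|nz] := pselect (exists z, z \in breaks R n /\ `|z - x0| < r / 2).
    by exists z => x xP xx; exact: sep.
  by exists 0 => x xP xx; case: nz; exists x.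
have r20 : 0 < r / 2 by lra.
set d := hwidth R n; set q := apex R n.
have [c [cx cP]] := shrink_avoiding [:: q - d; q; q + d; z] x0 r20.
move: cx cP => /=; have -> : r / 2 / 2 ^+ 4 = r / 32 by rewrite !exprS expr0; lra.
rewrite ler_norml => /andP[cx1 cx2] cP.
have [m [b mb]] : exists m b, forall x, c - r / 32 < x < c + r / 32 ->
    approx n.+1 x = m * x + b.
  apply: approx_affine => p; rewrite breaksS mem_cat => /orP[pP|pP].
    by apply: cP; move: pP; rewrite !inE => /or3P[] ->; rewrite ?orbT.
  have [/(zP _ pP) ->|] := ltP `|p - x0| (r / 2).
    by apply: cP; rewrite !inE eqxx !orbT.
  by case: (ger0P (p - x0)) => ? ?; [right|left]; lra.
have r320 : 0 < r / 32 by lra.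
have [c' [y' [cc' yy' miss]]] := affine_misses_quarter m b c y0 r320.
exists (c', y') => -[u v]; rewrite /eball /= => uv.
have := norm1_le_edist (c', y') (u, v); have := norm2_le_edist (c', y') (u, v).
move: cc' yy' => /=; rewrite !ler_norml => /andP[? ?] /andP[? ?] /andP[? ?] /andP[? ?].
split.
  apply: le_lt_trans (edist_le_norms _ _) _ => /=.
  by case: (ger0P (x0 - u)); case: (ger0P (y0 - v)); lra.
move=> [_ /= vE].
apply: (miss u (approx n.+1 u)).
- by rewrite ltr_norml; apply/andP; split; lra.
- have := approx_le_limit n.+1 u; have := limit_le_approx n.+1 u.
  by rewrite -vE ltr_norml => ? ?; apply/andP; split; lra.
- by rewrite mb//; apply/andP; split; lra.
Qed.

End Porosity.

(** * Monotone sets over dense sets of abscissas *)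

Section Monotone.
Variable R : realType.
Implicit Types (f : R -> R) (D : set R).

Definition continuous_at_all f := forall x e : R, 0 < e ->
  exists r : R, 0 < r /\ forall y, `|y - x| < r -> `|f y - f x| < e.

(** An order placing the apex [t] between the feet [x] and [y] violates monotonicity with constant
    [c]. The feet are compared in the sum norm, which dominates [edist]. *)
Definition spiky f := forall a b c : R, a < b -> 0 < c ->
  exists x t y, [/\ a < x, x < t, t < y & y < b] /\
    c * (`|x - y| + `|f x - f y|) < f t - f x /\
    c * (`|x - y| + `|f x - f y|) < f t - f y.

Definition dense_between D (a b : R) := forall x e : R, a < x < b -> 0 < e ->
  exists y, D y /\ `|y - x| < e.

(* Take the supremum of the part of [u, v] where [A] holds. *)
Lemma boundary_pair f D a b u v (A : R -> Prop) (e : R) :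
  continuous_at_all f -> dense_between D a b -> 0 < e ->
  a < u -> u < v -> v < b -> D u -> D v -> A u -> ~ A v ->
  exists m m', [/\ D m, D m', u <= m <= v & u <= m' <= v] /\
    [/\ A m, ~ A m', `|m - m'| < e & `|f m - f m'| < e].
Proof.
move=> fc Dd e0 au uv vb Du Dv Au nAv.
pose S := [set x | [/\ u <= x, x <= v, D x & A x]].
have Su : S u by split=> //; exact: ltW.
have Sub : has_ubound S by exists v => x [].
have Ss : has_sup S by split => //; exists u.
pose s := sup S.
have us : u <= s by exact: ub_le_sup.
have sv : s <= v by apply: ge_sup; [exists u|move=> x []].
have e20 : 0 < e / 2 by lra.
have [r [r0 fr]] := fc s _ e20.
pose d := Num.min r (e / 2).
have d0 : 0 < d by rewrite lt_min r0.
have dr : d <= r by rewrite ge_min lexx.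
have de : d <= e / 2 by rewrite ge_min lexx orbT.
have [m Sm sm] := sup_adherent d0 Ss.
have ms : m <= s by exact: ub_le_sup.
case: Sm => um mv Dm Am; rewrite -/s in sm.
have [m' [Dm' sm' m'v nAm' m's]] :
    exists m', [/\ D m', s <= m', m' <= v, ~ A m' & m' < s + d].
  (* Near the right end [v] itself serves; otherwise a point of [D] just above the supremum does,
     since it cannot belong to [S]. *)
  have [vs|sdv] := ltP v (s + d); first by exists v.
  have mid : a < s + d / 2 < b by apply/andP; split; lra.
  have d20 : 0 < d / 2 by lra.
  have [m' [Dm']] := Dd _ _ mid d20; rewrite ltr_norml => /andP[? ?].
  exists m'; split => //; try lra.
  move=> Am'; have : m' <= s by apply: ub_le_sup => //; split => //; lra.
  lra.
have : `|f m - f s| < e / 2 by apply: fr; rewrite ltr_norml; apply/andP; split; lra.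
have : `|f m' - f s| < e / 2 by apply: fr; rewrite ltr_norml; apply/andP; split; lra.
rewrite !ltr_norml => /andP[? ?] /andP[? ?].
exists m, m'; split.
  by split => //; apply/andP; split; lra.
by split => //; rewrite ltr_norml; apply/andP; split; lra.
Qed.

(** The feet and apex of a spike need not lie in [D]; the strict inequalities survive their
    replacement by nearby points of [D]. *)
Lemma spike_stable f (c x t y : R) : 0 < c -> x < t -> t < y ->
  c * (`|x - y| + `|f x - f y|) < f t - f x ->
  c * (`|x - y| + `|f x - f y|) < f t - f y ->
  exists e, 0 < e /\ forall x' t' y',
    `|x' - x| < e -> `|f x' - f x| < e -> `|t' - t| < e -> `|f t' - f t| < e ->
    `|y' - y| < e -> `|f y' - f y| < e ->
    [/\ x' < t', t' < y',
        c * edist (x', f x') (y', f y') < edist (x', f x') (t', f t') &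
        c * edist (x', f x') (y', f y') < edist (y', f y') (t', f t')].
Proof.
set E := _ + _ => c0 xt ty h1 h2.
pose s := Num.min (f t - f x - c * E) (f t - f y - c * E).
have s0 : 0 < s by rewrite lt_min !subr_gt0 h1 h2.
(* The perturbation enlarges [c * E] by at most [4 * c * e] and lowers each height by at most
   [2 * e]; the slack [s] covers both. The other two bounds preserve the order of abscissas. *)
pose e := Num.min (s / (4 * c + 2)) (Num.min ((t - x) / 2) ((y - t) / 2)).
have ec : e * (4 * c + 2) <= s.
  by rewrite -ler_pdivlMr; [rewrite ge_min lexx|lra].
have s1 : s <= f t - f x - c * E by rewrite ge_min lexx.
have s2 : s <= f t - f y - c * E by rewrite ge_min lexx orbT.
have e0 : 0 < e by rewrite !lt_min !divr_gt0// ?subr_gt0//; lra.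
have etx : e <= (t - x) / 2 by rewrite !ge_min lexx !orbT.
have eyt : e <= (y - t) / 2 by rewrite !ge_min lexx !orbT.
clearbody e s; clear s0 h1 h2 xt ty; exists e; split => // x' t' y' xx fxx tt ftt yy fyy.
have dist_le (p q p' q' : R) : `|p' - p| < e -> `|q' - q| < e ->
    `|p' - q'| <= `|p - q| + 2 * e.
  clear; rewrite (_ : p' - q' = (p - q) + ((p' - p) - (q' - q))); last lra.
  move=> hp hq; apply: le_trans (ler_normD _ _) _; rewrite lerD2l.
  by apply: le_trans (ler_normB _ _) _; lra.
have bound : c * edist (x', f x') (y', f y') <= c * E + 4 * (c * e).
  rewrite (_ : _ + _ = c * (E + 4 * e)); last lra.
  rewrite ler_pM2l//; apply: le_trans (edist_le_norms _ _) _ => /=.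
  have := dist_le _ _ _ _ xx yy; have := dist_le _ _ _ _ fxx fyy.
  by clear; rewrite /E; lra.
have far z : c * E + 4 * (c * e) < f t' - f z ->
    c * edist (x', f x') (y', f y') < edist (z, f z) (t', f t').
  move=> h; apply: le_lt_trans bound (lt_le_trans h _).
  apply: le_trans (norm2_le_edist (z, f z) (t', f t')) => /=.
  by rewrite distrC ler_norm.
clear bound dist_le; move: xx fxx tt ftt yy fyy; rewrite !ltr_norml.
move=> /andP[_ x1] /andP[_ fx1] /andP[t1 t2] /andP[ft1 _] /andP[y1 _] /andP[_ fy1].
split.
- by clear -x1 t1 etx; lra.
- by clear -y1 t2 eyt; lra.
- by apply: far; clear -fx1 ft1 s1 ec; lra.
- by apply: far; clear -fy1 ft1 s2 ec; lra.
Qed.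

Lemma monotone_not_dense f D (a b : R) :
  continuous_at_all f -> spiky f -> a < b ->
  monotone_set [set (x, f x) | x in D] -> ~ dense_between D a b.
Proof.
move=> fc fs ab [lt [c [_ _ tot c0 mon]]] Dd.
pose l x y := lt (x, f x) (y, f y).
pose dd x y := edist (x, f x) (y, f y).
have inD x : D x -> [set (x, f x) | x in D] (x, f x) by move=> Dx; exists x.
have {}tot x y : D x -> D y -> x <> y -> l x y \/ l y x.
  by move=> /inD Dx /inD Dy xy; apply: tot => // -[].
have {}mon x y z : D x -> D y -> D z -> l x y -> l y z -> dd x y <= c * dd x z.
  by move=> /inD Dx /inD Dy /inD Dz; exact: mon.
have approxD x e : a < x < b -> 0 < e ->
    exists y, [/\ D y, `|y - x| < e & `|f y - f x| < e].
  move=> xab e0; have [r [r0 fr]] := fc x _ e0.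
  have re : 0 < Num.min r e by rewrite lt_min r0.
  have [y [Dy]] := Dd _ _ xab re; rewrite lt_min => /andP[? ?].
  by exists y; split => //; exact: fr.
(* A point whose abscissa lies outside [[u, v]] cannot be strictly between the points over [u] and
   [v] in the order. *)
have gap u v y : a < u -> u < v -> v < b -> D u -> D v -> D y ->
    y < u \/ v < y -> (l u y /\ l y v) \/ (l v y /\ l y u) -> False.
  move=> au uv vb Du Dv Dy yuv uyv.
  have [g [g0 gP]] : exists g, 0 < g /\ forall m, u <= m <= v -> g <= `|m - y|.
    case: yuv => yuv; [exists (u - y)|exists (y - v)]; split; try lra;
      by move=> m /andP[? ?]; case: (ger0P (m - y)) => ?; lra.
  (* Two points this close in both coordinates are at distance less than [g / c], so an
     order-intermediate [y] would be closer than [g] to the first of them. *)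
  have e0 : 0 < g / (2 * c + 1) by rewrite divr_gt0//; lra.
  have key m m' : D m -> D m' -> u <= m <= v -> l m y -> l y m' ->
      `|m - m'| < g / (2 * c + 1) -> `|f m - f m'| < g / (2 * c + 1) -> False.
    move=> Dm Dm' muv my ym'; rewrite !ltr_pdivlMr; [|lra|lra] => h1 h2.
    have h3 := mon _ _ _ Dm Dy Dm' my ym'.
    have := gP _ muv; have := norm1_le_edist (m, f m) (y, f y) => /= h4 h5.
    have h6 : c * dd m m' <= c * (`|m - m'| + `|f m - f m'|).
      by rewrite ler_pM2l//; exact: edist_le_norms.
    rewrite -/(dd m y) in h4.
    have := normr_ge0 (m - m'); have := normr_ge0 (f m - f m'); lra.
  have neq m : u <= m <= v -> m <> y by move=> /andP[? ?] my; case: yuv; lra.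
  have asym x : D x -> u <= x <= v -> ~ l x y -> l y x.
    by move=> Dx xuv nxy; have [] := tot _ _ Dx Dy (neq _ xuv).
  have asym' x : D x -> u <= x <= v -> ~ l y x -> l x y.
    by move=> Dx xuv nxy; have [] := tot _ _ Dx Dy (neq _ xuv).
  have uuv : u <= u <= v by apply/andP; split; lra.
  have vuv : u <= v <= v by apply/andP; split; lra.
  (* Taking [m = m'] in [key] gives asymmetry with respect to [y]. *)
  have irr x : D x -> u <= x <= v -> l x y -> l y x -> False.
    move=> Dx xuv xy yx; apply: (key x x) => //; by rewrite subrr normr0.
  case: uyv => -[h1 h2].
    have nv : ~ l v y by move=> vy; exact: (irr v).
    have [m [m' [[Dm Dm' muv m'uv] [my nm'y mm' fmm']]]] :=
      @boundary_pair f D a b u v (fun x => l x y) _ fc Dd e0 au uv vb Du Dv h1 nv.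
    by apply: (key m m') => //; exact: asym.
  have nv : ~ l y v by move=> yv; exact: (irr v).
  have [m [m' [[Dm Dm' muv m'uv] [my nm'y mm' fmm']]]] :=
    @boundary_pair f D a b u v (fun x => l y x) _ fc Dd e0 au uv vb Du Dv h2 nv.
  by apply: (key m' m) => //; rewrite 1?distrC//; exact: asym'.
have [x [t [y [[ax xt ty yb] [h1 h2]]]]] := fs _ _ _ ab c0.
have [e [e0 He]] := spike_stable c0 xt ty h1 h2.
pose e' := Num.min e (Num.min (x - a) (b - y)).
have e'0 : 0 < e' by rewrite !lt_min e0 !subr_gt0 ax yb.
have e'e : e' <= e by rewrite ge_min lexx.
have e'a : e' <= x - a by rewrite !ge_min lexx !orbT.
have e'b : e' <= b - y by rewrite !ge_min lexx !orbT.
have xb : x < b by apply: lt_trans xt (lt_trans ty yb).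
have ta : a < t by apply: lt_trans ax xt.
have tb : t < b by apply: lt_trans ty yb.
have ya : a < y by apply: lt_trans ta ty.
have [||x' [Dx xx fxx]] := approxD x e'; [by rewrite ax xb|by []|].
have [||t' [Dt tt ftt]] := approxD t e'; [by rewrite ta tb|by []|].
have [||y' [Dy yy fyy]] := approxD y e'; [by rewrite ya yb|by []|].
have ax' : a < x'.
  by move: xx; rewrite ltr_norml => /andP[h _]; clear -h e'a; lra.
have yb' : y' < b.
  by move: yy; rewrite ltr_norml => /andP[_ h]; clear -h e'b; lra.
have [||||||xt' ty' farx fary] := He x' t' y'; do ?exact: lt_le_trans e'e.
have at' : a < t' by exact: lt_trans ax' xt'.
have tb' : t' < b by exact: lt_trans ty' yb'.
have ne (u v : R) : u < v -> u <> v by move=> uv uE; rewrite uE ltxx in uv.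
(* If the apex lies between the feet in the order, [farx] or [fary] contradicts monotonicity.
   Otherwise one foot lies between the apex and the other foot, although its abscissa is outside the
   arc joining them, against [gap]. *)
have [hxt|hxt] := tot _ _ Dx Dt (ne _ _ xt');
  have [hty|hty] := tot _ _ Dt Dy (ne _ _ ty').
- by have := mon _ _ _ Dx Dt Dy hxt hty; rewrite leNgt farx.
- have [hxy|hxy] := tot _ _ Dx Dy (ne _ _ (lt_trans xt' ty')).
  + by apply: (gap x' t' y') => //; [right|left].
  + by apply: (gap t' y' x') => //; [left|right].
- have [hxy|hxy] := tot _ _ Dx Dy (ne _ _ (lt_trans xt' ty')).
  + by apply: (gap t' y' x') => //; [left|left].
  + by apply: (gap x' t' y') => //; [right|right].
- by have := mon _ _ _ Dy Dt Dx hty hxt; rewrite /dd (edistC _ (x', _)) leNgt fary.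
Qed.

End Monotone.

(** * Spikes of the limit function and smallness of monotone subsets *)

Lemma limit_spiky (R : realType) : spiky (@limit R).
Proof.
move=> a b c ab c0.
have [q] := rat_in_itvoo ab; rewrite in_itv/= => /andP[aq qb].
have [k [ck kq1 kq2]] : exists k : nat,
    [/\ c <= k%:R, 1 < (ratr q - a) * k.+1%:R & 1 < (b - ratr q) * k.+1%:R].
  (* One large index [k] serves twice: it beats the ratio [c], and, since the half-width is below
     [1 / k.+1], it puts the tent at [q] inside []a, b[]. *)
  pose B := Num.max c (Num.max (ratr q - a)^-1 (b - ratr q)^-1).
  exists (Num.truncn B).+1.
  have hB : B < (Num.truncn B).+1%:R by exact: truncnS_gt.
  have hB2 : B < (Num.truncn B).+2%:R by rewrite (lt_trans hB)// ltr_nat.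
  have [? ? ?] : [/\ c <= B, (ratr q - a)^-1 <= B & (b - ratr q)^-1 <= B].
    by split; rewrite /B !le_max lexx ?orbT.
  split; first by lra.
    by rewrite mulrC -ltr_pdivrMr ?subr_gt0// mul1r; lra.
  by rewrite mulrC -ltr_pdivrMr ?subr_gt0// mul1r; lra.
pose n := pickle (q, k).
have sn : spot n = (q, k) by rewrite /spot pickleK.
have qE : apex R n = ratr q by rewrite /apex sn.
have slE : slope R n = k.+1%:R * (5 + 2 * lip R n).
  by rewrite /slope /slope_for sn.
set d := hwidth R n; set L := lip R n in slE.
have L0 : 0 <= L by exact: lip_ge0.
have d0 : 0 < d by exact: hwidth_gt0.
have h := heightE R n; rewrite slE -/d in h.
have s1 : scale R n <= 1.
  have := scale_le R n; have := scale_gt0 R n => s0.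
  have : scale R n * 1 <= scale R n * n.+1%:R by rewrite ler_wpM2l ?ler1n// ltW.
  lra.
have k0 : 0 <= k.+1%:R :> R by [].
have kd : d * k.+1%:R < 1.
  have : 0 <= k.+1%:R * L * d by apply: mulr_ge0 (ltW d0); exact: mulr_ge0.
  have : 0 <= k.+1%:R * d by exact: mulr_ge0 (ltW d0).
  lra.
have dq1 : d < ratr q - a by rewrite -(@ltr_pM2r _ k.+1%:R)//; lra.
have dq2 : d < b - ratr q by rewrite -(@ltr_pM2r _ k.+1%:R)//; lra.
have dr := scaleS_le_hwidth R n; rewrite -/d in dr.
set x := ratr q in qE dq1 dq2 aq qb *.
have at0 : approx n.+1 x = approx n x + k.+1%:R * (5 + 2 * L) * d.
  by rewrite approxS /bump qE tent_center ?slE// ltW.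
have al : approx n.+1 (x - d) = approx n (x - d).
  by rewrite approxS /bump qE tent_left ?addr0// ltW.
have ar : approx n.+1 (x + d) = approx n (x + d).
  by rewrite approxS /bump qE tent_right ?addr0// ltW.
have := approx_le_limit n.+1 x; have := limit_le_approx n.+1 (x - d).
have := limit_le_approx n.+1 (x + d).
have := approx_le_limit n.+1 (x - d); have := approx_le_limit n.+1 (x + d).
rewrite at0 al ar.
have l1 : `|approx n x - approx n (x - d)| <= L * d.
  apply: le_trans (approx_lip _ _ _) _.
  by rewrite (_ : x - (x - d) = d) ?(ger0_norm (ltW d0))//; lra.
have l2 : `|approx n x - approx n (x + d)| <= L * d.
  apply: le_trans (approx_lip _ _ _) _.
  by rewrite (_ : x - (x + d) = - d) ?normrN ?(ger0_norm (ltW d0))//; lra.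
move: l1 l2; rewrite !ler_norml => /andP[? ?] /andP[? ?] ? ? ? ? ?.
have f1 : `|limit (x - d) - limit (x + d)| <= (2 * L + 1) * d.
  by rewrite ler_norml; apply/andP; split; lra.
have xd : `|x - d - (x + d)| = 2 * d.
  by rewrite (_ : x - d - (x + d) = - (2 * d)) ?normrN ?ger0_norm//; lra.
have main : c * (`|x - d - (x + d)| + `|limit (x - d) - limit (x + d)|) <=
    k%:R * ((3 + 2 * L) * d).
  rewrite xd; apply: ler_pM; [exact: ltW| |exact: ck|lra].
  by rewrite addr_ge0//; lra.
have kk : k.+1%:R = k%:R + 1 :> R by rewrite natr1.
have : 0 <= k%:R * d by exact: mulr_ge0 (ltW d0).
have : 0 <= L * d by exact: mulr_ge0 (ltW d0).
rewrite kk in at0 h *.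
move=> ? ?; exists (x - d), x, (x + d); split; first by split; lra.
split; lra.
Qed.

Lemma graph01_subsetE (R : realType) (f : R -> R) (M : set (R * R)) :
  M `<=` graph01 f -> [set (x, f x) | x in [set x | M (x, f x)]] = M.
Proof.
move=> MG; apply/seteqP; split => [_ [x Mx <-]//|[x y] Mxy].
by have [_ /= yE] := MG _ Mxy; rewrite yE in Mxy *; exists x.
Qed.

Lemma limit_nowhere_dense (R : realType) (M : set (R * R)) :
  M `<=` graph01 (@limit R) -> monotone_set M ->
  nowhere_dense_in (graph01 (@limit R)) M.
Proof.
move=> MG Mmon; rewrite /nowhere_dense_in -subset0 => -[x0 y0] [[/= x01 ->{y0}]].
move=> [e [e0 H]]; pose D := [set x | M (x, limit x)].
have e20 : 0 < e / 2 by lra.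
have [r [r0 fr]] := limit_continuous x0 e20.
pose d := Num.min r (e / 2).
have d0 : 0 < d by rewrite lt_min r0.
have dr : d <= r by rewrite ge_min lexx.
have de : d <= e / 2 by rewrite ge_min lexx orbT.
(* Over []a, b[] the graph stays within [e] of its point at [x0], hence in the closure of [M].
   Projecting to the first coordinate then makes [D] dense there. *)
pose a := Num.max 0 (x0 - d); pose b := Num.min 1 (x0 + d).
have ab : a < b.
  rewrite lt_min !gt_max; move: x01 => /andP[? ?].
  by apply/andP; split; apply/andP; split; lra.
rewrite -(graph01_subsetE MG) in Mmon.
apply: (monotone_not_dense (@limit_continuous R) (@limit_spiky R) ab Mmon).
move=> x r' /andP[]; rewrite gt_max lt_min => /andP[? ?] /andP[? ?] r'0.
have [||_ /(_ _ r'0)[[y z] [Myz xyz]]] := H (x, limit x).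
- by split => //=; apply/andP; split; lra.
- apply: le_lt_trans (edist_le_norms _ _) _ => /=.
  have : `|x - x0| < d by rewrite ltr_norml; apply/andP; split; lra.
  move=> xx0; have := fr x (lt_le_trans xx0 dr).
  by rewrite (distrC x0) (distrC (limit x0)); lra.
have [_ /= zE] := MG _ Myz; exists y; split; first by rewrite /D /= -zE.
by rewrite distrC; exact: le_lt_trans (norm1_le_edist (x, limit x) (y, z)) xyz.
Qed.

(** Baire's theorem is applied on the line of abscissas: the projections [D n] are nowhere dense in
    it, so some point of []0, 1[] avoids all their closures. *)
Lemma limit_not_sigma_monotone (R : realType) :
  ~ sigma_monotone (graph01 (@limit R)).
Proof.
move=> [A [AP GA]]; pose D n := [set x | A n (x, limit x)].
have Dmon n : monotone_set [set (x, limit x) | x in D n].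
  by have [AG] := AP n; rewrite graph01_subsetE.
have /Baire : forall n, open (~` closure (D n)) /\ dense (~` closure (D n) : set R).
  move=> n; split; first exact/closed_openC/closed_closure.
  move=> O [x Ox] oO; apply: contrapT => OD.
  have /nbhs_ballP[e /= e0 eO] : nbhs x O by exact: open_nbhs_nbhs.
  have ab : x - e < x + e by lra.
  apply: (monotone_not_dense (@limit_continuous R) (@limit_spiky R) ab (Dmon n)).
  move=> y r /andP[? ?] r0.
  have : closure (D n) y.
    apply: contrapT => yD; apply: OD; exists y; split => //.
    by apply: eO; rewrite /ball /= ltr_norml; apply/andP; split; lra.
  move=> /(_ _ (nbhsx_ballx y r r0))[z [Dz yz]]; exists z; split => //.
  by rewrite distrC.
move=> /(_ `]0, 1[%classic); case.
- by exists (2^-1); rewrite /= in_itv /=; apply/andP; split; lra.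
- exact: interval_open.
move=> x [/=]; rewrite in_itv /= => /andP[x0 x1] xU.
have : graph01 (@limit R) (x, limit x) by split => //=; rewrite !ltW.
by rewrite GA => -[n _ Anx]; apply: (xU n I); exact: subset_closure.
Qed.

Theorem theorem7p3 (R : realType) :
  exists f : R -> R,
    [/\ abs_continuous_on 0 1 f,
        strongly_porous (graph01 f),
        (forall M : set (R * R), M `<=` graph01 f -> monotone_set M ->
           nowhere_dense_in (graph01 f) M) &
        ~ sigma_monotone (graph01 f)].
Proof.
exists (@limit R); split.
- exact: limit_abs_continuous.
- exact: limit_strongly_porous.
- exact: limit_nowhere_dense.
- exact: limit_not_sigma_monotone.
Qed.
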